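(* Let $d>3$ be an integer, let $\mathbb{k}$ be a field of characteristic $0$ or of characteristic greater than $d$, and let $n\ge 1$ be an integer. Let $x=(x_1,x_2)$ and $y=(y_1,y_2)$ be two systems of independent indeterminates over $\mathbb{k}$. Then there exist $z_1,\dots,z_n\in\mathbb{k}(x)[y]$, each of which is a linear form in $y_1,y_2$ with coefficients in the rational function field $\mathbb{k}(x)=\mathbb{k}(x_1,x_2)$, such that \[ (x_1^d + x_2^d)\,(y_1^d + y_2^d) = z_1^d + z_2^d + \cdots + z_n^d \] holds in $\mathbb{k}(x)[y]$ if and only if $n>3$.
   Context: A linear form in $y$ with coefficients in $\mathbb{k}(x)$ is an expression $c_1y_1+c_2y_2$ with $c_1,c_2\in\mathbb{k}(x)$ (the zero form is allowed). *)

(* Defs.v *)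
From mathcomp Require Export all_boot all_order all_algebra.
From mathcomp Require Export fraction.
From mathcomp.multinomials Require Export mpoly.

Set Implicit Arguments.
Unset Strict Implicit.
Unset Printing Implicit Defensive.

Import GRing.Theory.
Local Open Scope ring_scope.

(* The rational function field k(x_1, x_2). *)
Definition ratfun2 (k : fieldType) : fieldType := {fraction {mpoly k[2]}}.

(* Indices are 0-based: xvar k 0 and yvar k 0 stand for x_1 and y_1. *)
Definition xvar (k : fieldType) (i : 'I_2) : ratfun2 k :=
  tofrac ('X_i : {mpoly k[2]}).

Definition yvar (k : fieldType) (i : 'I_2) : {mpoly (ratfun2 k)[2]} := 'X_i.

Definition is_linear_form (k : fieldType) (z : {mpoly (ratfun2 k)[2]}) : Prop :=
  exists c1 c2 : ratfun2 k, z = c1 *: yvar k 0 + c2 *: yvar k 1.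

(* Main.v *)
(* Put a = x_1^d + x_2^d and z_i = b_i y_1 + c_i y_2.  Comparing coefficients,
   the mixed moments sum_i b_i^(d-j) c_i^j with 0 < j < d vanish, while the two
   extreme ones equal a.  If n <= 3 < d, pairing these moments with the product
   of the linear forms vanishing at the points (b_i, c_i) off the axes gives
   a = sum_(c_i = 0) b_i^d = sum_(b_i = 0) c_i^d.  One of these sums has at most
   one nonzero term, so a is a d-th power in k(x).  This is impossible: after
   x_1 = X T, x_2 = T and passing to leading coefficients in T, the separable
   polynomial X^d + 1 would be a d-th power in k(X). *)
Require Import Defs.
Set Implicit Arguments.
Unset Strict Implicit.
Unset Printing Implicit Defensive.
Import GRing.Theory.
Local Open Scope ring_scope.

Lemma natr_neq0_pchar (R : fieldType) (d m : nat) :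
  [pchar R] =i pred0 \/ (exists2 p : nat, p \in [pchar R] & (d < p)%N) ->
  (0 < m <= d)%N -> m%:R != 0 :> R.
Proof.
move=> hR /andP[m_gt0 le_md]; case: hR => [/pcharf0P-> | [p pR lt_dp]].
  by rewrite -lt0n.
by rewrite -(dvdn_pcharf pR) gtnNdvd // (leq_ltn_trans le_md).
Qed.

(** The binomial coefficient divides [d!], a product of integers that are nonzero in [R]. *)
Lemma natr_bin_neq0 (R : idomainType) (d j : nat) :
  (forall m, (0 < m <= d)%N -> m%:R != 0 :> R) ->
  (j <= d)%N -> 'C(d, j)%:R != 0 :> R.
Proof.
move=> hR le_jd; have: (d`!)%:R != 0 :> R.
  elim: d hR {le_jd} => [|d IHd] hR; first exact: oner_neq0.
  rewrite factS natrM mulf_neq0 //; first by rewrite hR ?leqnn.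
  by apply: IHd => m /andP[m0 le_md]; rewrite hR // m0 leqW.
by rewrite -(bin_fact le_jd) natrM; apply: contraNneq => ->; rewrite mul0r.
Qed.

Section BinaryForms.

Variables (F : fieldType) (I : finType) (d : nat).

(* Pair the vanishing moments with the polynomial whose roots are the slopes
   c i / b i of the points off both axes: only the points on the axis c = 0
   survive. *)
Lemma sum_expr_on_axis (b c : I -> F) (a : F) :
  (#|I| < d)%N -> \sum_i b i ^+ d = a ->
  (forall j, (0 < j < d)%N -> \sum_i b i ^+ (d - j) * c i ^+ j = 0) ->
  a = \sum_(i | c i == 0) b i ^+ d.
Proof.
move=> lt_Id sum_b sum0; have d_gt0 : (0 < d)%N by apply: leq_ltn_trans lt_Id.
pose P := [pred i | (b i != 0) && (c i != 0)].
pose h := \prod_(i | P i) ('X - (c i / b i)%:P).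
(* Degree strictly below [d] keeps the extreme moment [j = d], which does not vanish, out of the
   pairing. *)
have sz_h : (size h <= d)%N.
  rewrite /h -big_enum size_prod_XsubC -cardE.
  by apply: leq_ltn_trans lt_Id; apply: max_card.
have h0 : h`_0 != 0.
  rewrite -horner_coef0 horner_prod; apply/prodf_neq0 => i /andP[b0 c0].
  by rewrite hornerXsubC sub0r oppr_eq0 mulf_neq0 ?invr_eq0.
apply: (mulIf h0); rewrite -sum_b.
transitivity (\sum_i b i ^+ d * h.[c i / b i]).
  transitivity (\sum_(j < d) h`_j * \sum_i b i ^+ (d - j) * c i ^+ j).
    rewrite (bigD1 (Ordinal d_gt0)) //= subn0 [X in _ + X]big1 => [|j j0].
      by rewrite addr0 mulrC; congr (_ * _); apply: eq_bigr => i _; rewrite mulr1.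
    by rewrite sum0 ?mulr0 // ltn_ord andbT lt0n.
  under eq_bigr do rewrite big_distrr.
  rewrite exchange_big; apply: eq_bigr => i _ /=.
  rewrite (horner_coef_wide _ sz_h) big_distrr; apply: eq_bigr => j _ /=.
  (* When [b i = 0] the slope is a junk value, but both sides vanish because [j < d]. *)
  have [-> | b0] := eqVneq (b i) 0.
    by rewrite !expr0n subn_eq0 leqNgt ltn_ord (gtn_eqF d_gt0) !mul0r mulr0.
  rewrite expr_div_n [RHS]mulrCA; congr (_ * _).
  by rewrite [RHS]mulrCA -expfB // mulrC.
rewrite (bigID (fun i => c i == 0)) /= [X in _ + X]big1 ?addr0 => [|i c0].
  rewrite big_distrl; apply: eq_bigr => i /eqP-> /=.
  by rewrite mul0r horner_coef0.
have [-> | b0] := eqVneq (b i) 0; first by rewrite expr0n (gtn_eqF d_gt0) mul0r.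
by rewrite horner_prod (bigD1 i) /= ?b0 ?c0 // hornerXsubC subrr mul0r mulr0.
Qed.

Lemma scaled_fermat_moments (b c : I -> F) (a : F) :
  (forall m, (0 < m <= d)%N -> m%:R != 0 :> F) -> (0 < d)%N ->
  a%:P * (1 + 'X^d) = \sum_i ((b i)%:P + c i *: 'X) ^+ d ->
  [/\ \sum_i b i ^+ d = a, \sum_i c i ^+ d = a &
    forall j, (0 < j < d)%N -> \sum_i b i ^+ (d - j) * c i ^+ j = 0].
Proof.
move=> hF d_gt0 eq_ad.
(* Coefficient of ['X^j] on each side; the binomial factor is cancelled for [0 < j < d] and is 1 at
   both ends. *)
have coefE j : (j <= d)%N ->
    a * ((j == 0%N)%:R + (j == d)%:R) =
    (\sum_i b i ^+ (d - j) * c i ^+ j) * 'C(d, j)%:R.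
  move=> le_jd; have := congr1 (fun p : {poly F} => p`_j) eq_ad.
  rewrite coefCM coefD coef1 coefXn coef_sum => ->.
  rewrite big_distrl; apply: eq_bigr => i _ /=.
  rewrite exprDn coef_sum (bigD1 (inord j)) //= inordK ?ltnS // big1 ?addr0.
    by rewrite coefMn -rmorphXn coefCM exprZn coefZ coefXn eqxx mulr1 mulr_natr.
  move=> l; rewrite -val_eqE /= inordK ?ltnS // => ne_lj.
  rewrite coefMn -rmorphXn coefCM exprZn coefZ coefXn eq_sym (negPf ne_lj).
  by rewrite !mulr0 mul0rn.
have d0 : (0 == d)%N = false by case: (d) d_gt0.
split=> [||j /andP[j0 ltjd]].
- have := coefE 0%N isT; rewrite bin0 mulr1 eqxx d0 addr0 mulr1 => ->.
  by apply: eq_bigr => i _; rewrite subn0 mulr1.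
- have := coefE d (leqnn d); rewrite binn mulr1 eqxx eq_sym d0 add0r mulr1 => ->.
  by apply: eq_bigr => i _; rewrite subnn mul1r.
have := coefE j (ltnW ltjd); rewrite (ltn_eqF ltjd) eqn0Ngt j0 addr0 mulr0.
move/esym/eqP; rewrite mulf_eq0 (negPf (natr_bin_neq0 hF (ltnW ltjd))) orbF.
by move/eqP.
Qed.

(* The nonzero points on the two axes form disjoint families with at most three
   elements in total, so one of them has at most one element. *)
Lemma scaled_fermat_expr (b c : I -> F) (a : F) :
  (forall m, (0 < m <= d)%N -> m%:R != 0 :> F) ->
  (3 < d)%N -> (#|I| <= 3)%N ->
  a%:P * (1 + 'X^d) = \sum_i ((b i)%:P + c i *: 'X) ^+ d ->
  exists u, a = u ^+ d.
Proof.
move=> hF d3 I3 eq_ad; have d_gt0 : (0 < d)%N by apply: leq_trans d3.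
have [sum_b sum_c sum0] := scaled_fermat_moments hF d_gt0 eq_ad.
have sum0' j : (0 < j < d)%N -> \sum_i c i ^+ (d - j) * b i ^+ j = 0.
  move=> /andP[j0 ltjd]; rewrite -[RHS](sum0 (d - j)%N).
    by apply: eq_bigr => i _; rewrite subKn 1?ltnW // mulrC.
  by rewrite subn_gt0 ltjd ltn_subrL j0.
have lt_Id : (#|I| < d)%N by apply: leq_ltn_trans d3.
have aE := sum_expr_on_axis lt_Id sum_b sum0.
have aE' := sum_expr_on_axis lt_Id sum_c sum0'.
pose S (e f : I -> F) := [set i | (f i == 0) && (e i != 0)].
have key (e f : I -> F) : a = \sum_(i | f i == 0) e i ^+ d ->
    (#|S e f| <= 1)%N -> exists u, a = u ^+ d.
  move=> aE0 card1; have {}aE0 : a = \sum_(i in S e f) e i ^+ d.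
    rewrite aE0 (bigID (fun i => e i != 0)) /= [X in _ + X]big1 ?addr0.
      by apply: eq_bigl => i; rewrite inE.
    move=> i /andP[_]; rewrite negbK => /eqP->.
    by rewrite expr0n (gtn_eqF d_gt0).
  move: card1; rewrite leq_eqVlt ltnS leqn0 cards_eq0.
  case/orP=> [/cards1P[i eq_i] | /eqP eq0].
    by exists (e i); rewrite aE0 eq_i big_set1.
  by exists 0; rewrite aE0 eq0 big_set0 expr0n (gtn_eqF d_gt0).
have [|A1] := leqP #|S b c| 1; first exact: key aE.
apply: (key c b aE'); rewrite leqNgt; apply/negP => B1.
suff : (#|S b c| + #|S c b| <= 3)%N.
  by rewrite leqNgt; apply/negP; rewrite negbK (leq_add A1 B1).
apply: leq_trans I3; rewrite -cardsUI disjoint_setI0.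
  by rewrite cards0 addn0 max_card.
rewrite disjoints_subset; apply/subsetP => i; rewrite !inE => /andP[/eqP-> _].
by rewrite eqxx andbF.
Qed.

End BinaryForms.

Lemma dehomogenize_fermat (F : fieldType) (I : finType) (d : nat)
    (b c : I -> F) (a : F) :
  a%:MP_[2] * ('X_0 ^+ d + 'X_1 ^+ d) = \sum_i (b i *: 'X_0 + c i *: 'X_1) ^+ d ->
  a%:P * (1 + 'X^d) = \sum_i ((b i)%:P + c i *: 'X) ^+ d.
Proof.
(* Set [y_1 = 1] and [y_2 = X]. *)
pose ev := mmap (@polyC F) (fun i : 'I_2 => if i == 0 then 1 else 'X).
move/(congr1 ev); rewrite /ev rmorphM rmorph_sum rmorphD !rmorphXn /=.
rewrite mmapC !mmapX !mmap1U /= expr1n => ->; apply: eq_bigr => i _.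
by rewrite rmorphXn rmorphD /= !mmapZ !mmapX !mmap1U /= mulr1 mul_polyC.
Qed.

Lemma fermat_product_expand (R : comNzRingType) (d n : nat) (x1 x2 : R) :
  (0 < d)%N -> (3 < n)%N -> exists b c : 'I_n -> R,
  (x1 ^+ d + x2 ^+ d)%:MP_[2] * ('X_0 ^+ d + 'X_1 ^+ d) =
    \sum_i (b i *: 'X_0 + c i *: 'X_1) ^+ d.
Proof.
move=> d0; case: n => [|[|[|[|n]]]] // _.
(* The forms are [x1 y_1, x2 y_1, x1 y_2, x2 y_2]; past the lists the default 0 pads with zero
   forms. *)
exists (fun i => [:: x1; x2]`_i), (fun i => [:: 0; 0; x1; x2]`_i).
rewrite !big_ord_recl big1 /= => [|i _]; last first.
  by rewrite !nth_default // !scale0r addr0 expr0n (gtn_eqF d0).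
rewrite !scale0r !addr0 !add0r !exprZn mul_mpolyC scalerDr !scalerDl.
by rewrite !addrA.
Qed.

(* The quotient of p by q is linear, and its root would be a multiple root of the
   separable polynomial 'X^d + c. *)
Lemma Xn_addC_not_expr (R : fieldType) (d : nat) (c : R) (p q : {poly R}) :
  (1 < d)%N -> d%:R != 0 :> R -> c != 0 -> q != 0 ->
  p ^+ d <> ('X^d + c%:P) * q ^+ d.
Proof.
move=> d1 dR c0 q0 eq_pq; have d_gt0 := ltnW d1.
have /dvdpP[u p_uq] : q %| p.
  by rewrite -(dvdp_pexp2r _ _ d_gt0) eq_pq dvdp_mull.
have {p p_uq eq_pq} uE : u ^+ d = 'X^d + c%:P.
  by apply: (@mulIf _ (q ^+ d)); rewrite ?expf_neq0 // -eq_pq p_uq exprMn.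
(* Comparing degrees in [u ^+ d = 'X^d + c] forces [u] to have degree 1. *)
have sz_u : size u = 2.
  have := size_exp u d; rewrite uE size_XnaddC //= => /eqP.
  rewrite -[X in X == _]mul1n eqn_pmul2r // eq_sym => /eqP.
  by case: (size u) => // m /= ->.
have [r /eqP ur] := poly2_root sz_u.
have /eqP : (u ^+ d)^`().[r] = 0.
  rewrite deriv_exp hornerMn hornerM horner_exp ur expr0n.
  by rewrite -subn1 subn_eq0 leqNgt d1 mulr0 mul0rn.
rewrite uE derivD derivC derivXn addr0 hornerMn hornerXn.
rewrite -mulr_natr mulf_eq0 (negPf dR) orbF expf_eq0 => /andP[_ /eqP r0].
have := congr1 (fun p => p.[r]) uE.
rewrite horner_exp ur r0 hornerD hornerXn hornerC expr0n (gtn_eqF d_gt0) add0r.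
by move/esym/eqP; apply/negP.
Qed.

Lemma fraction_repr (R : idomainType) (u : {fraction R}) :
  exists p q : R, q != 0 /\ u * tofrac q = tofrac p.
Proof.
elim/quotW: u => x; exists \n_x, \d_x; split; first exact: denom_ratioP.
apply/eqP; unlock tofrac; rewrite -[X in X == _]FracField.pi_mul.
rewrite eqmodE /= FracField.equivfE /FracField.mulf.
by rewrite !numden_Ratio ?mulr1 ?oner_eq0 ?denom_ratioP // mulrC.
Qed.

(* The substitution x_1 = X T, x_2 = T, written in k[X][T]. *)
Definition blowup (k : fieldType) : {mpoly k[2]} -> {poly {poly k}} :=
  mmap (polyC \o polyC) (fun i => if i == 0 then 'X%:P * 'X else 'X).

(** The monomial with exponents [(a, b)] maps to [X^a T^(a+b)], so distinct monomials stay distinct;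
    injectivity follows. *)
Lemma coef_blowup (k : fieldType) (P : {mpoly k[2]}) (m : 'X_{1.. 2}) :
  (blowup P)`_(m ord0 + m 1)`_(m ord0) = P@_m.
Proof.
have coefm l : (blowup 'X_[l])`_(m ord0 + m 1)`_(m ord0) = (l == m)%:R.
  rewrite /blowup mmapX /mmap1 !big_ord_recl big_ord0 /= mulr1 exprMn -mulrA.
  rewrite -exprD -rmorphXn coefCM coefXn.
  have ->: lift ord0 ord0 = 1 :> 'I_2 by apply: val_inj.
  have [-> | ne_lm] := eqVneq l m; first by rewrite eqxx mulr1 coefXn eqxx.
  have [eq_deg | _] := eqVneq; last by rewrite mulr0 coef0.
  rewrite mulr1 coefXn; have [eq0 | //] := eqVneq.
  case/eqP: ne_lm; apply/mnmP => i; move: eq_deg; rewrite eq0 => /addnI eq1.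
  have [-> | ->] // : i = ord0 \/ i = 1.
  by case: i => [[|[|//]] lt_i]; [left | right]; apply: val_inj.
rewrite [in LHS](mpolyE P) [in RHS](mpolyE P) /blowup !raddf_sum !coef_sum /=.
apply: eq_bigr => l _; rewrite mmapZ /= coefCM coefCM mcoeffZ mcoeffX.
by rewrite -coefm.
Qed.

Lemma blowup_inj (k : fieldType) : injective (@blowup k).
Proof. by move=> P Q eqPQ; apply/mpolyP => m; rewrite -!coef_blowup eqPQ. Qed.

Lemma sum_Xn_not_expr (k : fieldType) (d : nat) (u : ratfun2 k) :
  (1 < d)%N -> d%:R != 0 :> k -> xvar k 0 ^+ d + xvar k 1 ^+ d <> u ^+ d.
Proof.
move=> d1 dk eq_u; have [p [q [q0 eq_pq]]] := fraction_repr u.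
have {eq_u eq_pq} : p ^+ d = ('X_0 ^+ d + 'X_1 ^+ d) * q ^+ d.
  apply/eqP; rewrite -tofrac_eq !(rmorphXn, rmorphM, rmorphD) /= -eq_pq exprMn.
  by rewrite -eq_u.
move/(congr1 (@blowup k)); rewrite /blowup !(rmorphXn, rmorphM, rmorphD) /=.
rewrite !mmapX !mmap1U /= -!/(blowup _).
(* The sum of powers has become [(X^d + 1) T^d], and [T^d] contributes 1 to the leading coefficient
   in [T]. *)
rewrite exprMn -[X in _ + X]mul1r -mulrDl => /(congr1 lead_coef).
rewrite !lead_coefM !lead_coef_exp lead_coefX expr1n mulr1.
have ->: 'X%:P ^+ d + 1 = ('X^d + 1%:P)%:P :> {poly {poly k}}.
  by rewrite rmorphD rmorphXn.
rewrite lead_coefC.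
have lq0 : lead_coef (blowup q) != 0.
  rewrite lead_coef_eq0; apply: contraNneq q0 => q_0.
  by apply/eqP/blowup_inj; rewrite q_0 /blowup raddf0.
apply: Xn_addC_not_expr d1 dk (oner_neq0 k) lq0.
Qed.

Theorem corollary3p5 (d : nat) (hd : (3 < d)%N) (k : fieldType)
  (hchar : [pchar k] =i pred0 \/ (exists2 p : nat, p \in [pchar k] & (d < p)%N))
  (n : nat) (hn : (1 <= n)%N) :
  (exists z : 'I_n -> {mpoly (ratfun2 k)[2]},
     (forall i : 'I_n, is_linear_form (z i)) /\
     (xvar k 0 ^+ d + xvar k 1 ^+ d)%:MP * (yvar k 0 ^+ d + yvar k 1 ^+ d)
       = \sum_(i < n) z i ^+ d)
  <-> (3 < n)%N.
Proof.
have hk m (m_in : (0 < m <= d)%N) := natr_neq0_pchar hchar m_in.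
split=> [[z [lin_z eq_z]] | n3].
  rewrite ltnNge; apply/negP => n_le3.
  have [b /fin_all_exists[c zE]] := fin_all_exists lin_z.
  (* The condition on the characteristic passes from [k] to [k(x)] along the embeddings. *)
  have hF m : (0 < m <= d)%N -> m%:R != 0 :> ratfun2 k.
    move=> m_in; rewrite -(rmorph_nat (@tofrac {mpoly k[2]})) tofrac_eq0.
    by rewrite -mpolyC_nat mpolyC_eq0 hk.
  move: eq_z; under eq_bigr do rewrite zE.
  move/dehomogenize_fermat/(scaled_fermat_expr hF hd).
  rewrite card_ord => /(_ n_le3)[u].
  apply: sum_Xn_not_expr; first exact: ltn_trans hd.
  by rewrite hk // leqnn andbT (ltn_trans _ hd).
have [b [c eq_bc]] :=
  fermat_product_expand (xvar k 0) (xvar k 1) (ltnW (ltnW (ltnW hd))) n3.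
exists (fun i => b i *: yvar k 0 + c i *: yvar k 1).
by split=> [i|//]; exists (b i), (c i).
Qed.
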